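(* Let $\tau$ be an rp-tree with $n$ leaves, and let $T_{v_i}\in\Theta_{|v_i|}$, with $v_i$ ranging over the internal vertices of $\tau$. Let $G\in\Gamma_n$ or $G\in o\Gamma_n$. Then $$\Big\langle G,\ f_\tau\big(\textstyle\bigotimes T_{v_i}\big)\Big\rangle=\Big\langle g_\tau(G),\ \textstyle\bigotimes T_{v_i}\Big\rangle_\otimes ,$$ where $\langle\cdot,\cdot\rangle_\otimes$ denotes the tensor product of the even configuration pairings if $G\in\Gamma_n$ (respectively of the odd configuration pairings if $G\in o\Gamma_n$), and $f_\tau$, $g_\tau$ are the corresponding even (respectively odd) structure maps.
   Context: Fix a commutative ground ring $R$; write $\mathbf n=\{1,\dots,n\}$. Trees and graphs. A Tree is an isotopy class of finite connected acyclic graphs whose vertices are trivalent (internal) or univalent, with a distinguished univalent root, embedded in the upper half-plane with root at the origin; non-root univalent vertices are leaves, labeled bijectively by $\mathbf n$. The height of a vertex is its edge-distance to the root; the nadir of a path is the vertex of lowest height it traverses. A Graph is a finite connected oriented graph, and an eoGraph is a finite connected (unoriented) graph with a total ordering of its edges, in both cases with vertices labeled bijectively by $\mathbf n$, each edge joining distinct vertices, multiple edges allowed. $\Theta_n,\Gamma_n,o\Gamma_n$ are the free $R$-modules on Trees, Graphs, eoGraphs labeled by $\mathbf n$. Configuration pairings. $\beta_{G,T}$ sends an edge $e$ of $G$ joining $i$ and $j$ to the nadir of the shortest path $p_T(e)$ between leaves $i$ and $j$ of $T$. In both cases $\langle G,T\rangle=0$ if $\beta_{G,T}$ is not a bijection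 from the edges of $G$ to the internal vertices of $T$. If it is a bijection: in the even case ($G$ a Graph) $\langle G,T\rangle=(-1)^N$, with $N$ the number of edges $e$ for which $p_T(e)$, directed according to $e$, travels from left to right at its nadir; in the odd case ($G$ an eoGraph) $\langle G,T\rangle$ is the sign of the permutation given by $\beta_{G,T}$ between the ordered set of edges of $G$ and the internal vertices of $T$ ordered from left to right (if $v$ sits over the left branch of $w$ then $v<w$; if over the right branch then $w<v$). Extend bilinearly. The same formulas are used for possibly disconnected graphs; the value is then always $0$, and a disconnected graph is regarded as $0$ in $\Gamma_m$ or $o\Gamma_m$. rp-trees. An rp-tree is a rooted planar tree in the upper half-plane with a root edge, whose internal vertices may have any number of branches; for an internal vertex $v$, $|v|$ is its valence minus one, i.e. its number of branches. Label the leaves of $\tau$ by $1,\dots,n$ and the branches of each internal vertex $v$ by $1,\dots,|v|$, from left to right. Fix an ordering of the internal vertices of $\tau$, used in all tensor products $\bigotimes_{v_i}$. The map $f_\tau:\bigotimes_{v_i}\Theta_{|v_i|}\to\Theta_n$. For Trees $T_{v_i}$, let $S$ be their grafting: whenever $v_i$ is the other vertex of the $k$th branch of $v_j$ in $\tau$, identify the root edge of $T_{v_i}$ with the leaf of $T_{v_j}$ labeled $k$; label the leaves of $S$ by $\mathbf n$ via the total order in which leaf $\ell$ is less than leaf $m$ if they sit over two different leaves of some $T_{v_i}$ and the leaf of $T_{v_i}$ under $\ell$ has smaller label than that under $m$ (so leaves of $S$ correspond to the leaves of $\tau$ with the same labels). In the even case $f_\tau(\bigotimes T_{v_i})=S$;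 in the odd case $f_\tau(\bigotimes T_{v_i})=\mathrm{sign}(\rho)S$, where $\rho$ is the permutation relating the order of internal vertices as they occur in $\bigotimes T_{v_i}$ (concatenating the orders of the factors) with the order of the corresponding internal vertices of $S$. The map $g_\tau$ on $\Gamma_n$ or $o\Gamma_n$. For distinct $j,k\in\mathbf n$ let $v$ be the nadir of the shortest path in $\tau$ between leaves $j$ and $k$, and let $J_v(j),J_v(k)\in\{1,\dots,|v|\}$ be the labels of the branches of $v$ over which leaves $j$ and $k$ lie. For $G$ a Graph or eoGraph, $G_{v}$ is the graph on vertices $\{1,\dots,|v|\}$ having, for each edge of $G$ between $j$ and $k$ whose associated nadir is $v$, an edge between $J_v(j)$ and $J_v(k)$ (oriented from $J_v(j)$ to $J_v(k)$ if the edge is $j\to k$; respectively, with edges ordered as the edges of $G$ giving rise to them). In the even case $g_\tau(G)=\bigotimes_{v_i}G_{v_i}$; in the odd case $g_\tau(G)=\mathrm{sign}(\pi)\bigotimes_{v_i}G_{v_i}$, where $\pi$ is the permutation relating the order of all edges in $\bigotimes_{v_i}G_{v_i}$ (concatenating factors) to their order within $G$. Extend linearly. *)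

(* Defs.v *)
From HB Require Import structures.
From mathcomp Require Import all_boot all_order all_fingroup all_algebra.
From mathcomp Require Export freeg.

Set Implicit Arguments.
Unset Strict Implicit.
Unset Printing Implicit Defensive.

Import GRing.Theory.
Local Open Scope ring_scope.

(* A vertex of a rooted planar tree is addressed by the sequence of branches
   taken to reach it, starting from the upper end of the root edge, which has
   the address [::]; hence its edge-distance to the root is one more than the
   length of its address. The root itself, at the lower end of the root edge,
   is on no path between leaves and gets no address. *)
Section Paths.
Variable A : eqType.
Implicit Types p q v : seq A.

Definition height v := (size v).+1.

(* The vertices from [::] up to p. *)
Definition stem p := [seq take m p | m <- iota 0 (size p).+1].

(* The vertices on the shortest path from p to q: as long as p and q go through
   the same branch the path stays in the subtree over it; otherwise it descends
   from p to [::] and climbs from there to q. *)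
Fixpoint tpath p q : seq (seq A) :=
  if (p, q) is (x :: p', y :: q') then
    if x == y then map (cons x) (tpath p' q')
    else rev (stem p) ++ behead (stem q)
  else rev (stem p) ++ behead (stem q).

Definition nadir p q : seq A :=
  let s := tpath p q in
  head [::] [seq v <- s | all (fun w => height v <= height w)%N s].

Definition lies_over v (x : A) p := prefix (rcons v x) p.

(* The nadir of an unoriented edge e, its two endpoints i, j being placed at
   addr i and addr j; the orientation of the path is irrelevant to its nadir. *)
Definition edge_nadir (I : finType) (addr : I -> seq A) (e : {set I}) : seq A :=
  if enum e is [:: i; j] then nadir (addr i) (addr j) else [::].

End Paths.

Section Orders.

(* For s, t two orderings of the same finite set (duplicate-free and
   rearrangements of each other), the permutation sending the position in s of
   an element to its position in t. *)
Definition order_perm (V : eqType) (s t : seq V) : 'S_(size s) :=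
  insubd (1%g : 'S_(size s))
    [ffun i : 'I_(size s) => insubd i (index (tnth (in_tuple s) i) t)].

Definition order_sign (R : comNzRingType) (V : eqType) (s t : seq V) : R :=
  (-1) ^+ order_perm s t.

Definition bijective_onto (E : finType) (V : eqType) (f : E -> V) (s : seq V) :=
  [&& injectiveb f, all [in s] (codom f) & all [in codom f] s].

End Orders.

(* Binary plane trees with a root edge; the branches of an internal vertex are
   false (left) and true (right). *)
Inductive btree (A : Type) := Leaf of A | Fork of btree A & btree A.

Section BTreeChoice.
Variable A : choiceType.

Fixpoint encode (t : btree A) : GenTree.tree A :=
  match t with
  | Leaf a => GenTree.Leaf a
  | Fork l r => GenTree.Node 0 [:: encode l; encode r]
  end.

Fixpoint decode (t : GenTree.tree A) : option (btree A) :=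
  match t with
  | GenTree.Leaf a => Some (Leaf a)
  | GenTree.Node _ [:: l; r] =>
      if (decode l, decode r) is (Some l', Some r') then Some (Fork l' r')
      else None
  | _ => None
  end.

Lemma encodeK : pcancel encode decode.
Proof. by elim=> //= l -> r ->. Qed.

HB.instance Definition _ := Choice.copy (btree A) (pcan_type encodeK).

End BTreeChoice.

Fixpoint leaves (A : Type) (t : btree A) : seq A :=
  match t with Leaf a => [:: a] | Fork l r => leaves l ++ leaves r end.

(* The internal vertices, from left to right. *)
Fixpoint inner (A : Type) (t : btree A) : seq (seq bool) :=
  match t with
  | Leaf _ => [::]
  | Fork l r => map (cons false) (inner l) ++ [::] :: map (cons true) (inner r)
  end.

(* The address of the leaf labeled a. *)
Fixpoint laddr (A : eqType) (t : btree A) (a : A) : seq bool :=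
  match t with
  | Leaf _ => [::]
  | Fork l r => if a \in leaves l then false :: laddr l a else true :: laddr r a
  end.

Fixpoint subst (A B : Type) (t : btree A) (f : A -> btree B) : btree B :=
  match t with
  | Leaf a => f a
  | Fork l r => Fork (subst l f) (subst r f)
  end.

Definition relabel (A B : Type) (f : A -> B) (t : btree A) : btree B :=
  subst t (fun a => Leaf (f a)).

Definition labeled n (t : btree 'I_n) := perm_eq (leaves t) (enum 'I_n).

(* Labels, of leaves as of vertices of graphs, are numbered from 0. *)
Definition tree n := {t : btree 'I_n | labeled t}.

Section Graphs.
Variable m : nat.

Definition connected (e : rel 'I_m) := [forall i, forall j, connect e i j].

(* An oriented multigraph on 'I_m, up to isomorphism fixing the vertices, is
   the number of its edges from i to j for all i, j. *)
Definition digraph := {ffun 'I_m * 'I_m -> nat}.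

Definition edges (g : digraph) := {p : 'I_m * 'I_m & 'I_(g p)}.

Definition is_graph (g : digraph) :=
  [forall i, g (i, i) == 0%N] && connected [rel i j | 0 < g (i, j) + g (j, i)]%N.

Definition graph := {g : digraph | is_graph g}.

(* A multigraph with totally ordered edges is the sequence of the pairs of
   endpoints of its edges. *)
Definition is_eograph (g : seq {set 'I_m}) :=
  all (fun e : {set 'I_m} => #|e| == 2%N) g &&
  connected [rel i j | [set i; j] \in g].

Definition eograph := {g : seq {set 'I_m} | is_eograph g}.

End Graphs.

Section Modules.
Variable R : comNzRingType.

Definition Theta n := {freeg (tree n) / R}.
Definition Gamma n := {freeg (graph n) / R}.
Definition oGamma n := {freeg (eograph n) / R}.

(* The element of Gamma m (or oGamma m) represented by a multigraph without
   loops: the multigraph if it is connected, and 0 otherwise. *)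
Definition gamma_of m (g : digraph m) : Gamma m :=
  if insub g is Some G then << (G : graph m) >> else 0.

Definition ogamma_of m (g : seq {set 'I_m}) : oGamma m :=
  if insub g is Some G then << (G : eograph m) >> else 0.

Definition bilin (K L : choiceType) (b : K -> L -> R)
    (x : {freeg K / R}) (y : {freeg L / R}) : R :=
  fglift (fun k => fglift (fun l => b k l : R^o) y : R^o) x.

(* The tensor product over I of the free modules on the B i is the free module
   on the families of basis elements; tens x is the pure tensor of the x i. *)
Section Tensor.
Variables (I : finType) (B : I -> choiceType).

Definition tensor := {freeg {dffun forall i, B i} / R}.

Definition tens (x : forall i, {freeg (B i) / R}) : tensor :=
  \sum_(k : {dffun forall i, seq_sub (dom (x i))})
    << \prod_i coeff (val (k i)) (x i)
       *g ([ffun i => val (k i)] : {dffun forall i, B i}) >>.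

End Tensor.

Definition tensor_pairing (I : finType) (B C : I -> choiceType)
    (b : forall i, B i -> C i -> R) : tensor B -> tensor C -> R :=
  bilin (fun (g : {dffun forall i, B i}) (t : {dffun forall i, C i}) =>
           \prod_i b i (g i) (t i)).

Section Pairings.
Variable n : nat.

Definition even_pair (G : graph n) (T : tree n) : R :=
  let g := val G in
  let t := val T in
  let b (e : edges g) := nadir (laddr t (tag e).1) (laddr t (tag e).2) in
  let left_to_right (e : edges g) :=
    lies_over (b e) false (laddr t (tag e).1) &&
    lies_over (b e) true (laddr t (tag e).2)
  in
  if bijective_onto b (inner t) then (-1) ^+ #|[set e | left_to_right e]|
  else 0.

Definition odd_pair (G : eograph n) (T : tree n) : R :=
  let g := val G in
  let t := val T in
  let b := edge_nadir (laddr t) in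
  if bijective_onto (fun i : 'I_(size g) => b (tnth (in_tuple g) i)) (inner t)
  then order_sign R [seq b e | e <- g] (inner t)
  else 0.

Definition even_pairing : Gamma n -> Theta n -> R := bilin even_pair.
Definition odd_pairing : oGamma n -> Theta n -> R := bilin odd_pair.

End Pairings.
End Modules.

(* An internal vertex has k.+1 >= 1 branches: without branches it would be
   univalent. The branches are numbered from left to right. *)
Inductive rptree :=
  | RLeaf
  | RNode (k : nat) of ('I_k.+1 -> rptree).

Fixpoint ivert (tau : rptree) : finType :=
  match tau with
  | RLeaf => void
  | RNode k br => option {i : 'I_k.+1 & ivert (br i)}
  end.

(* The internal vertex v of the branch br i, as a vertex of RNode br. *)
Definition up k (br : 'I_k.+1 -> rptree) (i : 'I_k.+1) (v : ivert (br i)) :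
  ivert (RNode br) := Some (Tagged (fun j => ivert (br j) : Type) v).

Fixpoint arity (tau : rptree) : ivert tau -> nat :=
  match tau with
  | RLeaf => fun _ => 0
  | RNode k br => fun v =>
      if v is Some u then arity (tagged u) else k.+1
  end.

Fixpoint vaddr (tau : rptree) : ivert tau -> seq nat :=
  match tau with
  | RLeaf => fun _ => [::]
  | RNode k br => fun v =>
      if v is Some u then val (tag u) :: vaddr (tagged u) else [::]
  end.

Fixpoint nleaves (tau : rptree) : nat :=
  match tau with
  | RLeaf => 1
  | RNode k br => \sum_(i < k.+1) nleaves (br i)
  end.

(* The leaves of tau are numbered from left to right: tagnat.Rank i l is the
   number in 'I_(\sum_i nleaves (br i)) of the leaf l of the branch br i, and
   tagnat.sig1 and tagnat.sig2 recover i and l from it. *)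
Fixpoint raddr (tau : rptree) : 'I_(nleaves tau) -> seq nat :=
  match tau with
  | RLeaf => fun _ => [::]
  | RNode k br => fun l =>
      val (tagnat.sig1 l) :: raddr (tagnat.sig2 l)
  end.

(* The grafting of the t v. Rank being lexicographic, the leaves are labeled in
   the order in which those over leaves i < j of t v, for any v, come in the same
   order as i and j. *)
Fixpoint graft (tau : rptree) :
    (forall v : ivert tau, btree 'I_(arity v)) -> btree 'I_(nleaves tau) :=
  match tau return (forall v : ivert tau, btree 'I_(arity v)) ->
                   btree 'I_(nleaves tau) with
  | RLeaf => fun _ => Leaf (ord0 : 'I_1)
  | RNode k br => fun t =>
      subst (t None) (fun i =>
        relabel (tagnat.Rank i)
          (@graft (br i) (fun v => t (up v))))
  end.

(* The address in graft t of the bottom vertex of t v: the internal vertex w of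
   t v becomes the internal vertex gaddr t v ++ w of graft t. *)
Fixpoint gaddr (tau : rptree) :
    (forall v : ivert tau, btree 'I_(arity v)) -> ivert tau -> seq bool :=
  match tau return (forall v : ivert tau, btree 'I_(arity v)) ->
                   ivert tau -> seq bool with
  | RLeaf => fun _ _ => [::]
  | RNode k br => fun t v =>
      if v is Some u then
        laddr (t None) (tag u) ++
        @gaddr (br (tag u)) (fun w => t (up w)) (tagged u)
      else [::]
  end.

Lemma leaves_subst (A B : Type) (t : btree A) (f : A -> btree B) :
  leaves (subst t f) = flatten [seq leaves (f a) | a <- leaves t].
Proof.
elim: t => [a|l IHl r IHr] /=; first by rewrite cats0.
by rewrite IHl IHr map_cat flatten_cat.
Qed.

Lemma leaves_relabel (A B : Type) (f : A -> B) (t : btree A) :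
  leaves (relabel f t) = map f (leaves t).
Proof. by elim: t => //= l IHl r IHr; rewrite IHl IHr map_cat. Qed.

Lemma graft_labeled (tau : rptree) (t : forall v : ivert tau, btree 'I_(arity v)) :
  (forall v, labeled (t v)) -> labeled (graft t).
Proof.
elim: tau t => [|k br IH] t labt /=.
  by rewrite /labeled /= (_ : enum _ = [:: ord0]) // enum_ordSl enum_ord0.
apply/seq.permP => a; rewrite leaves_subst count_flatten -map_comp sumnE big_map.
rewrite (perm_big _ (labt None)) big_enum -sum1_count big_enum_cond /=.
rewrite (reindex _ (onW_bij _ (@tagnat.rank_bij _ (fun i => nleaves (br i))))).
rewrite (eq_bigl (fun u => true && a (tagnat.Rank (tag u) (tagged u)))); last first.
  by move=> u; rewrite tagnat.rankE.
rewrite -(sig_big_dep xpredT (fun i l => a (tagnat.Rank i l)) (fun _ _ => 1%N)) /=.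
apply: eq_bigr => i _; rewrite leaves_relabel count_map.
have /seq.permP -> := IH i _ (fun v => labt (up v)).
by rewrite -sum1_count big_enum_cond.
Qed.

Section StructureMaps.
Variables (R : comNzRingType) (tau : rptree).
Local Notation n := (nleaves tau).
Local Notation trees := {dffun forall v : ivert tau, tree (arity v)}.

Definition Thetas := tensor R (fun v : ivert tau => tree (arity v)).
Definition Gammas := tensor R (fun v : ivert tau => graph (arity v)).
Definition oGammas := tensor R (fun v : ivert tau => eograph (arity v)).

Definition even_tpairing : Gammas -> Thetas -> R :=
  tensor_pairing (fun v => @even_pair R (arity v)).

Definition odd_tpairing : oGammas -> Thetas -> R :=
  tensor_pairing (fun v => @odd_pair R (arity v)).

Definition graft_tree (t : trees) : tree n :=
  exist _ (graft (fun v => val (t v))) (graft_labeled (fun v => valP (t v))).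

Definition even_f : Thetas -> Theta R n :=
  fglift (fun t : trees => << graft_tree t >>).

(* The internal vertices of the t v, as vertices of graft_tree t, concatenated
   in the order ord of the factors. *)
Definition tensor_inner (ord : seq (ivert tau)) (t : trees) : seq (seq bool) :=
  flatten [seq [seq gaddr (fun u => val (t u)) v ++ w | w <- inner (val (t v))]
          | v <- ord].

Definition odd_f (ord : seq (ivert tau)) : Thetas -> Theta R n :=
  fglift (fun t : trees =>
    << order_sign R (tensor_inner ord t) (inner (val (graft_tree t)))
       *g graft_tree t >>).

(* At the nadir v of the path between
   two leaves j and k, this says of l = j that a is J_v(j), and similarly for k. *)
Definition over_branch (v : ivert tau) (a : 'I_(arity v)) (l : 'I_n) :=
  lies_over (vaddr v) (val a) (raddr l).

(* No edge of even_restr g v or odd_restr g v is a loop, since the leaves whose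
   path has nadir v lie over different branches of v. *)
Definition even_restr (g : digraph n) (v : ivert tau) : digraph (arity v) :=
  [ffun p => (\sum_(q : 'I_n * 'I_n |
     [&& nadir (raddr q.1) (raddr q.2) == vaddr v,
         over_branch p.1 q.1 & over_branch p.2 q.2]) g q)%N].

Definition even_g : Gamma R n -> Gammas :=
  fglift (fun G : graph n => tens (fun v => gamma_of R (even_restr (val G) v))).

Definition odd_restr (g : seq {set 'I_n}) (v : ivert tau) :
    seq {set 'I_(arity v)} :=
  [seq [set a | [exists j in e, over_branch a j]]
  | e : {set 'I_n} <- g & edge_nadir (@raddr tau) e == vaddr v].

(* The edges of the odd_restr g v, as positions in g, concatenated in the order
   ord of the factors. *)
Definition tensor_edges (ord : seq (ivert tau)) (g : seq {set 'I_n}) : seq nat :=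
  flatten [seq [seq i <- iota 0 (size g)
               | edge_nadir (@raddr tau) (nth set0 g i) == vaddr v]
          | v <- ord].

Definition odd_g (ord : seq (ivert tau)) : oGamma R n -> oGammas :=
  fglift (fun G : eograph n =>
    order_sign R (tensor_edges ord (val G)) (iota 0 (size (val G)))
      *: tens (fun v => ogamma_of R (odd_restr (val G) v))).

End StructureMaps.

(* Main.v *)
Require Import Defs.
From mathcomp Require Import all_boot all_order all_fingroup all_algebra.

(* By bilinearity it is enough to pair a graph G with the grafting S of a family
   of trees t v. If the path between leaves j and k of tau has nadir v, then the
   addresses of j and k in S part inside the copy of t v, at the point where those
   of J_v(j) and J_v(k) part in t v. So the nadir map of G into S is the disjoint
   union over v of the nadir maps of the G_v into the t v, and it is a bijection
   iff they all are. The even sign counts the left-to-right edges, hence is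
   multiplicative over v; in the odd case both sides are products of signs of
   reorderings of the same vertices of S, and they agree by the cocycle rule
   sign(s, u) = sign(s, t) sign(t, u). A graph whose nadir map is onto is
   connected, which covers the disconnected G_v. *)

Set Implicit Arguments.
Unset Strict Implicit.
Unset Printing Implicit Defensive.

Import GRing.Theory.

(** * Bilinear extension *)

Section FreeModules.
Local Open Scope ring_scope.
Variable R : comNzRingType.

Lemma fgliftD (K : choiceType) (M : lmodType R) (f : K -> M) :
  {morph fglift f : x y / x + y}.
Proof.
move=> x y; have addf := lift_is_additive f.
(* [lift_is_additive] speaks of differences, so the sum is written [x - (0 - y)] and [0] as
   [0 - 0]. *)
by rewrite -{1}[y]opprK -[- y]add0r !addf -{1}[0](subrr 0) addf subrr sub0r opprK.
Qed.

Lemma fglift0 (K : choiceType) (M : lmodType R) (f : K -> M) : fglift f 0 = 0.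
Proof. by apply: (addrI (fglift f 0)); rewrite -fgliftD !addr0. Qed.

Lemma fglift1 (K : choiceType) (M : lmodType R) (f : K -> M) k :
  fglift f << k >> = f k.
Proof. by rewrite liftU scale1r. Qed.

Lemma fgscaleU (K : choiceType) (c d : R) (k : K) :
  c *: << d *g k >> = << c * d *g k >>.
Proof. by apply/eqP/freeg_eqP => l; rewrite coeffZ !coeffU mulrA. Qed.

Lemma freeg_ind (K : choiceType) (P : {freeg K / R} -> Prop) :
  P 0 -> (forall c k x, P x -> P (c *: << k >> + x)) -> forall x, P x.
Proof.
move=> P0 PD; apply: freeg_ind_dom0 => // c k x _ _ Px.
by rewrite -[c]mulr1 -fgscaleU; apply: PD.
Qed.

Lemma fgliftZ (K : choiceType) (M : lmodType R) (f : K -> M) (c : R) x :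
  fglift f (c *: x) = c *: fglift f x.
Proof.
elim/freeg_ind: x => [|d k x IH]; first by rewrite scaler0 fglift0 scaler0.
by rewrite scalerDr !fgliftD IH scalerDr !fgscaleU !liftU scalerA mulrA.
Qed.

Lemma eq_fglift (K : choiceType) (M : lmodType R) (f g : K -> M) :
  f =1 g -> fglift f =1 fglift g.
Proof.
move=> fg; elim/freeg_ind => [|c k x IH]; first by rewrite !fglift0.
by rewrite !fgliftD !fgliftZ !fglift1 IH fg.
Qed.

Lemma fglift_comp (K L : choiceType) (M : lmodType R)
    (f : L -> M) (g : K -> {freeg L / R}) x :
  fglift f (fglift g x) = fglift (fun k => fglift f (g k)) x.
Proof.
elim/freeg_ind: x => [|c k x IH]; first by rewrite !fglift0.
by rewrite !fgliftD !fgliftZ IH !fglift1.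
Qed.

Lemma bilinDl (K L : choiceType) (b : K -> L -> R) x x' y :
  bilin b (x + x') y = bilin b x y + bilin b x' y.
Proof. exact: (@fgliftD _ R^o). Qed.

Lemma bilinZl (K L : choiceType) (b : K -> L -> R) c x y :
  bilin b (c *: x) y = c * bilin b x y.
Proof. exact: (@fgliftZ _ R^o). Qed.

Lemma bilin0l (K L : choiceType) (b : K -> L -> R) y : bilin b 0 y = 0.
Proof. exact: (@fglift0 _ R^o). Qed.

(** Linearity of [bilin] is immediate in the first argument only; exchanging the arguments supplies
    it in the second. *)
Lemma bilinC (K L : choiceType) (b : K -> L -> R) x y :
  bilin b x y = bilin (fun l k => b k l) y x.
Proof.
elim/freeg_ind: x y => [|c k x IHx] y.
  rewrite bilin0l; elim/freeg_ind: y => [|d l y IHy]; first by rewrite bilin0l.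
  by rewrite bilinDl bilinZl -IHy addr0 /bilin fglift1 fglift0 mulr0.
rewrite bilinDl bilinZl {}IHx; elim/freeg_ind: y => [|d l y IHy].
  by rewrite /bilin !fglift0 fglift1 fglift0 mulr0 addr0.
rewrite ![bilin _ (_ + _) _]bilinDl -IHy ![bilin _ (d *: _) _]bilinZl.
rewrite /bilin !fglift1 !fgliftD !fgliftZ !fglift1 /=.
rewrite /GRing.scale/= !mulrDr -!addrA; congr (_ + _).
  by rewrite mulrCA.
by rewrite [RHS]addrCA.
Qed.

Lemma bilin11 (K L : choiceType) (b : K -> L -> R) k l :
  bilin b << k >> << l >> = b k l.
Proof. by rewrite /bilin !fglift1. Qed.

(** A linear map applied to one argument is absorbed into the kernel, which reduces identities of
    pairings to basis elements. *)
Lemma bilin_fglift_l (K K' L : choiceType) (b : K -> L -> R)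
    (f : K' -> {freeg K / R}) x y :
  bilin b (fglift f x) y = bilin (fun k l => bilin b (f k) << l >>) x y.
Proof.
rewrite /bilin fglift_comp; apply: (@eq_fglift _ R^o) => k.
rewrite -[LHS]/(bilin b (f k) y) bilinC.
apply: (@eq_fglift _ R^o) => l; rewrite -[RHS]/(bilin b (f k) << l >>) bilinC.
by rewrite /bilin fglift1.
Qed.

Lemma bilin_fglift_r (K L L' : choiceType) (b : K -> L -> R)
    (f : L' -> {freeg L / R}) x y :
  bilin b x (fglift f y) = bilin (fun k l => bilin b << k >> (f l)) x y.
Proof.
rewrite bilinC bilin_fglift_l bilinC; apply: (@eq_fglift _ R^o) => k.
by apply: (@eq_fglift _ R^o) => l; rewrite bilinC.
Qed.

Lemma eq_bilin (K L : choiceType) (b b' : K -> L -> R) :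
  b =2 b' -> bilin b =2 bilin b'.
Proof.
by move=> bb' x y; apply: (@eq_fglift _ R^o) => k; apply: (@eq_fglift _ R^o).
Qed.

(** * Pure tensors and their pairing *)

Section Tensor.
Variables (I : finType) (B : I -> choiceType).

(** Every support is a singleton, so the sum defining [tens] has the single index [c0], with
    coefficient 1. *)
Lemma tens_basis (x : forall i, {freeg (B i) / R}) (k : forall i, B i) :
  (forall i, x i = << k i >>) ->
  tens x = << [ffun i => k i] : {dffun forall i, B i} >>.
Proof.
move=> xE; have memk i : k i \in freeg.dom (x i) by rewrite xE domU1 inE.
pose c0 : {dffun forall i, seq_sub (freeg.dom (x i))} := [ffun i => SeqSub (memk i)].
have uniq_c (c : {dffun forall i, seq_sub (freeg.dom (x i))}) : c = c0.
  apply/ffunP => i; rewrite ffunE; apply: val_inj => /=.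
  by case: (c i) => /= z; rewrite xE domU1 inE => /eqP.
rewrite /tens (big_pred1 c0) => [|c]; last by rewrite /= (uniq_c c) eqxx.
rewrite big1 => [|i _]; last by rewrite ffunE /= xE coeffU eqxx mulr1.
by congr << _ *g _ >>; apply/ffunP => i; rewrite !ffunE.
Qed.

Lemma tens0 (x : forall i, {freeg (B i) / R}) i : x i = 0 -> tens x = 0.
Proof.
by move=> xi0; apply: big1 => k _; case: (k i) => z; rewrite xi0 dom0.
Qed.

(** The factors allowed here are the possible values of [gamma_of] and [ogamma_of]: a basis element
    for a connected graph, [0] for a disconnected one. *)
Lemma tensor_pairing_tens (C : I -> choiceType) (b : forall i, B i -> C i -> R)
    (x : forall i, {freeg (B i) / R}) (c : {dffun forall i, C i}) :
    (forall i, x i = 0 \/ exists k, x i = << k >>) ->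
  tensor_pairing b (tens x) << c >> = \prod_i bilin (b i) (x i) << c i >>.
Proof.
move=> xP; have [/existsP[i /eqP xi0]|] := boolP [exists i, x i == 0].
  by rewrite /tensor_pairing (tens0 xi0) bilin0l (bigD1 i) //= xi0 bilin0l mul0r.
rewrite negb_exists => /forallP xN0.
have /fin_all_exists[k xE] i : exists k, x i = << k >>.
  by case: (xP i) => // /eqP xi0; case/negP: (xN0 i).
rewrite (tens_basis xE) /tensor_pairing bilin11.
by apply: eq_bigr => i _; rewrite ffunE xE bilin11.
Qed.

End Tensor.
End FreeModules.

(** * Nadirs in binary trees *)

Section Nadir.
Variable A : eqType.
Implicit Types p q v w : seq A.

Fixpoint lcp p q :=
  if (p, q) is (x :: p', y :: q') then
    if x == y then x :: lcp p' q' else [::]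
  else [::].

(** While the addresses agree, both claims pass through [cons]; once they part, the path goes
    through [[::]], a prefix of everything. *)
Lemma lcp_tpath p q :
  lcp p q \in tpath p q /\ {in tpath p q, forall v, prefix (lcp p q) v}.
Proof.
have stem0 p' q' : [::] \in rev (stem p') ++ behead (stem q').
  by rewrite mem_cat mem_rev inE take0 eqxx.
elim: p q => [|x p IH] q; first by split=> [|v _]; [exact: stem0 | rewrite prefix0s].
case: q => [|y q]; first by split=> [|v _]; [exact: stem0 | rewrite prefix0s].
rewrite [lcp _ _]/= [tpath _ _]/=; case: (x =P y) => [_|_]; last first.
  by split=> [|v _]; [exact: (stem0 (x :: p) (y :: q)) | rewrite prefix0s].
have [lcp_in lcp_min] := IH q; split; first exact: map_f.
by move=> _ /mapP[v /lcp_min pre_v ->]; rewrite /= eqxx.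
Qed.

(** A vertex that extends the common prefix and is no higher equals it, so the filter keeps nothing
    else. *)
Lemma nadir_lcp p q : nadir p q = lcp p q.
Proof.
have [lcp_in lcp_min] := lcp_tpath p q; rewrite /nadir.
set s := filter _ _.
have: lcp p q \in s.
  rewrite mem_filter lcp_in andbT; apply/allP => w /lcp_min.
  exact: size_prefix.
have: {in s, forall v, v = lcp p q}.
  move=> v; rewrite mem_filter => /andP[/allP/(_ _ lcp_in) vmin /lcp_min].
  move/prefixP => [u vE]; move: vmin; rewrite vE /height size_cat ltnS
    -[leqRHS]addn0 leq_add2l leqn0 size_eq0.
  by move/eqP->; rewrite cats0.
by case: s => [|v s] /=; [rewrite in_nil | move=> /(_ v (mem_head _ _))].
Qed.

Lemma nadir_cons x y p q :
  nadir (x :: p) (y :: q) = if x == y then x :: nadir p q else [::].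
Proof. by rewrite !nadir_lcp. Qed.

Lemma nadir_split w x y p q :
  x != y -> nadir (w ++ x :: p) (w ++ y :: q) = w.
Proof.
move=> /negPf xy; elim: w => [|z w IH] /=; first by rewrite nadir_cons xy.
by rewrite nadir_cons eqxx IH.
Qed.

Lemma nadirC p q : nadir p q = nadir q p.
Proof.
rewrite !nadir_lcp; elim: p q => [|x p IH] [|y q] //=.
by rewrite eq_sym; case: eqP => // ->; rewrite IH.
Qed.

Lemma lies_over_cat v w x p : lies_over (v ++ w) x (v ++ p) = lies_over w x p.
Proof. by rewrite /lies_over rcons_cat; elim: v => //= y v IH; rewrite eqxx. Qed.

Lemma lies_over_split w x y p : lies_over w x (w ++ y :: p) = (x == y).
Proof. by rewrite -{1}[w]cats0 lies_over_cat /lies_over /= prefix0s andbT. Qed.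

(** [enum] may list the two endpoints in either order, which [nadirC] makes harmless. *)
Lemma edge_nadir2 (I : finType) (addr : I -> seq A) i j :
  i != j -> edge_nadir addr [set i; j] = nadir (addr i) (addr j).
Proof.
move=> ij; rewrite /edge_nadir.
have: perm_eq (enum [set i; j]) [:: i; j].
  apply: uniq_perm; rewrite ?enum_uniq //= ?inE ?ij // => k.
  by rewrite mem_enum !inE.
case: (enum _) => [|k [|l [|m u]]] perm_kl; try by have := perm_size perm_kl.
have:= perm_mem perm_kl k; rewrite !inE eqxx => /esym/orP[]/eqP kE.
  move: perm_kl; rewrite kE perm_cons => /perm_mem/(_ l).
  by rewrite !inE eqxx => /esym/eqP->.
have : perm_eq [:: k; l] [:: j; i] by rewrite (permPl perm_kl) (perm_catC [:: i] [:: j]).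
rewrite kE perm_cons => /perm_mem/(_ l).
by rewrite !inE eqxx => /esym/eqP->; rewrite nadirC.
Qed.

End Nadir.

(** * Leaf addresses and internal vertices *)

Section BinaryTrees.
Variable A : eqType.
Implicit Types t : btree A.

(** This explicit parting of two addresses yields both the nadir, by [nadir_split], and the sides of
    the path, by [lies_over_split]. *)
Lemma laddr_split t a b : a \in leaves t -> b \in leaves t -> a != b ->
  exists w x y p q, [/\ x != y, w \in inner t,
    laddr t a = w ++ x :: p & laddr t b = w ++ y :: q].
Proof.
elim: t => [c|l IHl r IHr] /=.
  by rewrite !inE => /eqP-> /eqP->; rewrite eqxx.
rewrite !mem_cat; case: ifP => la; case: ifP => lb /= ta tb ab.
- have [w [x [y [p [q [xy wl -> ->]]]]]] := IHl la lb ab.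
  exists (false :: w), x, y, p, q; split=> //.
  by rewrite mem_cat map_f.
- exists [::], false, true; do 2!eexists; split=> //.
  by rewrite mem_cat inE eqxx orbT.
- exists [::], true, false; do 2!eexists; split=> //.
  by rewrite mem_cat inE eqxx orbT.
have [w [x [y [p [q [xy wr -> ->]]]]]] := IHr ta tb ab.
exists (true :: w), x, y, p, q; split=> //.
by rewrite mem_cat inE /= map_f ?orbT.
Qed.

Lemma uniq_inner t : uniq (inner t).
Proof.
elim: t => //= l IHl r IHr; rewrite cat_uniq /= !map_inj_uniq; try by move=> ? ? [].
rewrite IHl IHr andbT !negb_or /= -!andbA; apply/and3P; split.
- by apply/mapP => -[].
- by apply/hasPn => _ /mapP[v _ ->]; apply/mapP => -[].
by apply/mapP => -[].
Qed.

End BinaryTrees.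

(* Only surjectivity of the nadir map is needed: the vertex [::] has an edge
   joining the two branches, each of which is connected by induction. *)
Lemma inner_connected (A : finType) (t : btree A) (e : rel A) :
    connect_sym e ->
    (forall w, w \in inner t -> exists i j, [/\ i \in leaves t, j \in leaves t,
       i != j, nadir (laddr t i) (laddr t j) = w & e i j]) ->
  {in leaves t &, forall i j, connect e i j}.
Proof.
move=> sym_e; elim: t => [a|l IHl r IHr] /= cov.
  by move=> i j; rewrite !inE => /eqP-> /eqP->; apply: connect0.
have conl : {in leaves l &, forall i j, connect e i j}.
  apply: IHl => w wl; have [|i [j []]] := cov (false :: w).
    by rewrite mem_cat map_f.
  (* A nadir [false :: w] forces both ends into [l]: ends in different branches give [[::]], two
     ends in [r] give a nadir starting with [true]. *)
  case: ifP => il; case: ifP => jl _ _ ij;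
    rewrite nadir_cons ?eqxx //= => -[eq_w] eij.
  by exists i, j.
have conr : {in leaves r &, forall i j, connect e i j}.
  apply: IHr => w wl; have [|i [j []]] := cov (true :: w).
    by rewrite mem_cat inE /= map_f ?orbT.
  rewrite !mem_cat; case: ifP => il; case: ifP => jl ir jr ij;
    rewrite nadir_cons ?eqxx //= => -[eq_w] eij.
  by exists i, j.
have conlr : {in leaves l & leaves r, forall i j, connect e i j}.
  have [|i [j []]] := cov [::]; first by rewrite mem_cat inE eqxx orbT.
  rewrite !mem_cat; case: ifP => il; case: ifP => jl ir jr ij;
    rewrite nadir_cons ?eqxx //= => _ eij a b al br.
  - rewrite (connect_trans (conl _ _ al il))//.
    by rewrite (connect_trans (connect1 eij)) ?conr.
  rewrite (connect_trans (conl _ _ al jl))// (connect_trans _ (conr _ _ ir br))//.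
  by rewrite sym_e connect1.
move=> i j; rewrite !mem_cat => /orP[il|ir] /orP[jl|jr]; try by auto.
by rewrite sym_e conlr.
Qed.

(** * Signs of reorderings *)

Section OrderSign.
Local Open Scope ring_scope.
Variable R : comNzRingType.

(* order_perm s t lives in 'S_(size s), so that signs of reorderings of s and of
   t cannot be compared without a cast; here n is any name for the size. *)
Lemma order_signE (V : eqType) (x0 : V) n (p : 'S_n) s t :
    uniq t -> size s = n -> size t = n ->
    (forall i, nth x0 t (p i) = nth x0 s i) ->
  order_sign R s t = (-1) ^+ p.
Proof.
move=> uniq_t sz_s; case: _ / sz_s p => p sz_t pE.
rewrite /order_sign /order_perm; set f := finfun _.
(* Once [f] underlies a permutation, [insubd] returns that permutation and not its default [1]. *)
suff -> : f = val p by rewrite valKd.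
apply/ffunP => i; rewrite ffunE -[RHS]/(pval p i) pvalE; apply: val_inj.
by rewrite val_insubd (tnth_nth x0) /= -pE index_uniq ?sz_t ?ltn_ord.
Qed.

Lemma perm_eq_nth (V : eqType) (x0 : V) (s t : seq V) : perm_eq s t ->
  exists p : 'S_(size s), forall i, nth x0 t (p i) = nth x0 s i.
Proof.
move=> st; move: (perm_size st) => /eqP sz.
have /tuple_permP[p sE] : perm_eq s (tcast (esym (eqP sz)) (in_tuple t)).
  by rewrite val_tcast.
exists p => i; have -> := congr1 (fun u => nth x0 u i) sE.
by rewrite -tnth_nth tnth_mktuple (tnth_nth x0) val_tcast.
Qed.

Lemma order_sign_nil (V : eqType) (t : seq V) : order_sign R [::] t = 1.
Proof.
rewrite /order_sign (_ : order_perm _ _ = 1%g) ?odd_perm1 //.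
by apply/permP => -[].
Qed.

(** The cocycle rule: in [p * q] the factor [p] acts first, so the product carries positions in [s]
    to positions in [u] by way of [t]. *)
Lemma order_sign_trans (V : eqType) (s t u : seq V) :
    uniq s -> perm_eq s t -> perm_eq t u ->
  order_sign R s u = order_sign R s t * order_sign R t u.
Proof.
(* An empty [s] offers no default element for [nth] and is treated apart. *)
case: s => [|x0 s].
  by rewrite perm_sym => _ /perm_nilP -> _; rewrite !order_sign_nil mul1r.
move: {s}(x0 :: s) => s uniq_s st tu.
have uniq_t : uniq t by rewrite -(perm_uniq st).
have uniq_u : uniq u by rewrite -(perm_uniq tu).
have sz_t : size t = size s by rewrite (perm_size st).
have sz_u : size u = size s by rewrite -(perm_size tu).
have [p pE] := perm_eq_nth x0 st; have := perm_eq_nth x0 tu.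
rewrite sz_t => -[q qE].
rewrite (order_signE (s := s) (t := t) uniq_t _ _ pE) //.
rewrite (order_signE (s := t) (t := u) uniq_u _ _ qE) //.
rewrite (order_signE (x0 := x0) (s := s) (t := u) (p := (p * q)%g)) //.
  by rewrite odd_permM signr_addb.
by move=> i; rewrite permM qE pE.
Qed.

Lemma order_sign_sqr (V : eqType) (s t : seq V) :
  order_sign R s t * order_sign R s t = 1.
Proof. by rewrite -signr_addb addbb. Qed.

Lemma order_sign_map (V W : eqType) (f : V -> W) (s t : seq V) :
    uniq (map f s) -> perm_eq s t ->
  order_sign R (map f s) (map f t) = order_sign R s t.
Proof.
case: s => [|x0 s].
  by rewrite perm_sym => _ /perm_nilP ->; rewrite !order_sign_nil.
move: {s}(x0 :: s) => s uniq_fs st.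
have uniq_t : uniq t by rewrite -(perm_uniq st) (map_uniq uniq_fs).
have uniq_ft : uniq (map f t) by rewrite -(perm_uniq (perm_map f st)).
have [p pE] := perm_eq_nth x0 st.
rewrite (order_signE (x0 := x0) (p := p)) // -?(perm_size st) //.
rewrite (order_signE (x0 := f x0) (p := p)) ?size_map // -?(perm_size st) // => i.
by rewrite !(nth_map x0) ?pE // -(perm_size st).
Qed.

(** The permutation is [p] with a fixed point added at position 0; lifting at equal positions
    preserves parity. *)
Lemma order_sign_cons (V : eqType) (x : V) (s t : seq V) :
  uniq (x :: s) -> perm_eq s t ->
  order_sign R (x :: s) (x :: t) = order_sign R s t.
Proof.
move=> uniq_s st; have [p pE] := perm_eq_nth x st.
have uniq_t : uniq (x :: t) by rewrite -(perm_uniq (s1 := x :: s)) ?perm_cons.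
have /andP[_ uniq_t'] := uniq_t.
rewrite (order_signE (x0 := x) (s := s) (p := p)) // -?(perm_size st) //.
rewrite (order_signE (x0 := x) (p := lift_perm ord0 ord0 p)) //= -?(perm_size st) //.
  by rewrite odd_lift_perm.
move=> i; case: (unliftP ord0 i) => [j ->|->]; last by rewrite lift_perm_id.
by rewrite lift_perm_lift /= pE.
Qed.

Lemma order_sign_rcons (V : eqType) (x : V) (s t : seq V) :
  uniq (rcons s x) -> perm_eq s t ->
  order_sign R (rcons s x) (rcons t x) = order_sign R s t.
Proof.
move=> uniq_s st; have [p pE] := perm_eq_nth x st.
have uniq_t : uniq (rcons t x).
  by rewrite -(perm_uniq (s1 := rcons s x)) // -!cats1 perm_cat2r.
have := uniq_t; rewrite rcons_uniq => /andP[_ uniq_t'].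
rewrite (order_signE (x0 := x) (s := s) (p := p)) // -?(perm_size st) //.
rewrite (order_signE (x0 := x) (p := lift_perm ord_max ord_max p)) //=
  ?size_rcons -?(perm_size st) //.
  by rewrite odd_lift_perm addbb.
move=> i; case: (unliftP ord_max i) => [j ->|->].
  by rewrite lift_perm_lift !nth_rcons !lift_max -(perm_size st) !ltn_ord pE.
by rewrite lift_perm_id /= !nth_rcons -(perm_size st) !ltnn eqxx.
Qed.

(** The cocycle rule passes through [t1 ++ s2]; the block common to the two sides of each factor is
    then stripped element by element, from its outer end. *)
Lemma order_sign_cat (V : eqType) (s1 s2 t1 t2 : seq V) :
    uniq (s1 ++ s2) -> perm_eq s1 t1 -> perm_eq s2 t2 ->
  order_sign R (s1 ++ s2) (t1 ++ t2) = order_sign R s1 t1 * order_sign R s2 t2.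
Proof.
move=> uniq_s st1 st2.
rewrite (@order_sign_trans _ _ (t1 ++ s2)) ?perm_cat2l ?perm_cat2r //.
have uniq_t : uniq (t1 ++ s2) by rewrite -(perm_uniq (s1 := s1 ++ s2)) // perm_cat2r.
congr (_ * _).
  elim/last_ind: s2 uniq_s {st2 uniq_t} => [|s2 x IH]; first by rewrite !cats0.
  rewrite -!rcons_cat => uniq_s; rewrite order_sign_rcons ?perm_cat2r // IH //.
  by move: uniq_s; rewrite rcons_uniq => /andP[].
elim: t1 uniq_t {st1} => [|x t1 IH] //= uniq_t.
by rewrite order_sign_cons ?perm_cat2l // IH //; case/andP: uniq_t.
Qed.

Lemma order_sign_flatten (V : eqType) (I : Type) (r : seq I) (s t : I -> seq V) :
    uniq (flatten (map s r)) -> (forall i, perm_eq (s i) (t i)) ->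
  order_sign R (flatten (map s r)) (flatten (map t r)) =
    \prod_(i <- r) order_sign R (s i) (t i).
Proof.
move=> + st; elim: r => [|i r IH] /= uniq_s; first by rewrite big_nil order_sign_nil.
rewrite big_cons order_sign_cat // ?IH //.
  by move: uniq_s; rewrite cat_uniq => /and3P[].
by elim: r {IH uniq_s} => //= j r; apply: perm_cat.
Qed.

End OrderSign.

(** * Grafting *)

Section Substitution.

(** [laddr] turns left exactly when the label occurs on the left; as [b] occurs only in the piece
    over [a], its turns inside [t] are those towards [a]. *)
Lemma laddr_subst (A B : eqType) (t : btree A) (f : A -> btree B) a b :
    a \in leaves t -> b \in leaves (f a) ->
    {in leaves t, forall a', b \in leaves (f a') -> a' = a} ->
  laddr (subst t f) b = laddr t a ++ laddr (f a) b.
Proof.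
move=> + fab; elim: t => [c|l IHl r IHr] /=.
  by rewrite inE => /eqP-> _.
rewrite mem_cat => ta uniq_a.
have -> : (b \in leaves (subst l f)) = (a \in leaves l).
  rewrite leaves_subst; apply/flatten_mapP/idP => [[a' la' ba']|la]; last by exists a.
  by rewrite -(uniq_a a') // mem_cat la'.
case: ifP ta => la /= ta; congr cons.
  by apply: IHl => // a' la'; apply: uniq_a; rewrite mem_cat la'.
by apply: IHr => // a' ra'; apply: uniq_a; rewrite mem_cat ra' orbT.
Qed.

Lemma laddr_relabel (A B : eqType) (f : A -> B) (t : btree A) a :
  injective f -> laddr (relabel f t) (f a) = laddr t a.
Proof.
move=> inj_f; elim: t => //= l IHl r IHr.
by rewrite leaves_relabel mem_map // IHl IHr.
Qed.

Lemma inner_relabel (A B : Type) (f : A -> B) (t : btree A) :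
  inner (relabel f t) = inner t.
Proof. by elim: t => //= l -> r ->. Qed.

(** From left to right the vertices of the pieces interleave with those of [t], so the decomposition
    holds up to rearrangement and is stated by counts. Distinct labels ensure that [laddr t a]
    addresses the leaf at which [f a] is inserted. *)
Lemma count_inner_subst (A : eqType) (B : Type) (t : btree A) (f : A -> btree B)
    (P : pred (seq bool)) : uniq (leaves t) ->
  count P (inner (subst t f)) = count P (inner t) +
    \sum_(a <- leaves t) count P [seq laddr t a ++ w | w <- inner (f a)].
Proof.
elim: t P => [a|l IHl r IHr] P /=; first by rewrite big_seq1 map_id.
rewrite cat_uniq => /and3P[uniq_l /hasPn lr uniq_r].
rewrite !count_cat /= !count_map !{}IHl // !{}IHr // big_cat /=.
pose addr a := if a \in leaves l then false :: laddr l a else true :: laddr r a.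
have -> : \sum_(a <- leaves l) count P [seq addr a ++ w | w <- inner (f a)] =
    \sum_(a <- leaves l)
      count (preim (cons false) P) [seq laddr l a ++ w | w <- inner (f a)].
  rewrite !big_seq; apply: eq_bigr => a la.
  by rewrite /addr la !count_map.
have -> : \sum_(a <- leaves r) count P [seq addr a ++ w | w <- inner (f a)] =
    \sum_(a <- leaves r)
      count (preim (cons true) P) [seq laddr r a ++ w | w <- inner (f a)].
  rewrite !big_seq; apply: eq_bigr => a ra.
  by rewrite /addr (negPf (lr _ ra)) !count_map.
set x := count _ (inner l); set y := count _ (inner r).
rewrite -!addnA; congr (_ + _); rewrite addnCA; congr (_ + _).
by rewrite [RHS]addnCA; congr (_ + _); rewrite addnCA.
Qed.

End Substitution.

(** * Addresses in planar trees and in graftings *)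

Section PlanarTrees.
Implicit Type tau : rptree.

Lemma arity_gt0 tau (v : ivert tau) : 0 < arity v.
Proof. by elim: tau v => [[]|k br IH [[i v]|]] //=. Qed.

Lemma vaddr_inj tau : injective (@vaddr tau).
Proof.
elim: tau => [[]|k br IH] //= [[i v]|] [[i' v']|] //= [/val_inj ii'].
by case: _ / ii' v' => v' /IH->.
Qed.

Lemma raddr_Rank k (br : 'I_k.+1 -> rptree) (i : 'I_k.+1) (l : 'I_(nleaves (br i))) :
  @raddr (RNode br) (tagnat.Rank i l) = val i :: raddr l.
Proof. by rewrite /= /tagnat.sig1 /tagnat.sig2 /tagnat.Rank tagnat.rankK. Qed.

Lemma RankP k (p_ : 'I_k -> nat) (l : 'I_(\sum_i p_ i)) :
  exists i (j : 'I_(p_ i)), l = tagnat.Rank i j.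
Proof. by exists (tagnat.sig1 l), (tagnat.sig2 l); rewrite tagnat.sig2K. Qed.

Lemma Rank_inj k (p_ : 'I_k -> nat) i : injective (@tagnat.Rank k p_ i).
Proof. by move=> l m /tagnat.rank_inj/eqP; rewrite eq_Tagged => /eqP. Qed.

Lemma over_branch_inj tau (v : ivert tau) a b l :
  over_branch (v := v) a l -> over_branch (v := v) b l -> a = b.
Proof.
rewrite /over_branch /lies_over => /prefixP[p ->].
by rewrite cat_rcons -/(lies_over _ _ _) lies_over_split => /eqP/val_inj.
Qed.

Lemma over_branch_split tau (j k : 'I_(nleaves tau)) : j != k ->
  exists (v : ivert tau) a b,
    [/\ a != b, over_branch (v := v) a j & over_branch (v := v) b k].
Proof.
elim: tau j k => [|m br IH] /= j k; first by rewrite !ord1.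
have [i [l ->]] := RankP j; have [i' [l' ->]] := RankP k => ll'.
have [ii'|ii'] := eqVneq i i'; last first.
  exists None, i, i'; split=> //; rewrite /over_branch (raddr_Rank (br := br));
  by rewrite /lies_over /= eqxx prefix0s.
case: _ / ii' l' ll' => l' ll'.
have {}ll' : l != l' by apply: contraNneq ll' => ->.
have [v [a [b [ab al bl']]]] := IH _ _ _ ll'.
exists (up v), a, b; split=> //; rewrite /over_branch (raddr_Rank (br := br));
  by rewrite /lies_over /= eqxx.
Qed.

Lemma nadir_raddr tau (v : ivert tau) a b j k : a != b ->
    over_branch (v := v) a j -> over_branch (v := v) b k ->
  nadir (raddr j) (raddr k) = vaddr v.
Proof.
rewrite /over_branch => ab /prefixP[p ->] /prefixP[q ->].
by rewrite !cat_rcons nadir_split.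
Qed.

Lemma mem_labeled n (t : btree 'I_n) i : labeled t -> i \in leaves t.
Proof. by move/perm_mem->; rewrite mem_enum. Qed.

Lemma laddr_graft_Rank k (br : 'I_k.+1 -> rptree)
    (t : forall v : ivert (RNode br), btree 'I_(arity v)) i l :
    (forall v, labeled (t v)) ->
  laddr (graft t) (tagnat.Rank i l) =
    laddr (t None) i ++ laddr (graft (fun v => t (up (i := i) v))) l.
Proof.
move=> labt; rewrite [graft t]/= (@laddr_subst _ _ _ _ i).
- by rewrite laddr_relabel //; apply: Rank_inj.
- exact: (mem_labeled _ (labt None)).
- rewrite leaves_relabel map_f //; apply: mem_labeled; apply: graft_labeled => v.
  exact: (labt (up v)).
(* [tagnat.Rank i l] determines [i], so pieces over different leaves share no label. *)
move=> i' _; rewrite leaves_relabel => /mapP[l' _] /(congr1 (@tagnat.sig1 _ _)).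
by rewrite !tagnat.Rank1K.
Qed.

(** Each level of [tau] below [v] prepends the same address to both sides; at [v = None] the climb
    above [t v] is what [p] collects. *)
Lemma laddr_graft tau (t : forall v : ivert tau, btree 'I_(arity v)) v a l :
    (forall v, labeled (t v)) -> over_branch (v := v) a l ->
  exists p, laddr (graft t) l = gaddr t v ++ laddr (t v) a ++ p.
Proof.
elim: tau t v a l => [|k br IH] t; first by case.
move=> v a l; have [i [l' ->]] := RankP l => labt.
rewrite /over_branch (raddr_Rank (br := br)) (laddr_graft_Rank _ labt).
case: v a => [[i' v]|] a; rewrite /lies_over /=; last first.
  rewrite prefix0s andbT => /eqP/val_inj ->.
  by eexists.
case/andP => /eqP/val_inj ii'; case: _ / ii' l' => l' over_l'.
have [|p ->] := IH i' (fun v => t (up v)) v a l' _ over_l'.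
  by move=> w; apply: (labt (up w)).
by exists p; rewrite catA.
Qed.

Lemma big_option (T : finType) (F : option T -> nat) :
  \sum_v F v = F None + \sum_(x : T) F (Some x).
Proof.
rewrite (bigD1 None) //=; congr (_ + _).
rewrite (reindex_omap Some id) => [|[]] //=.
by apply: eq_bigl => x; rewrite eqxx.
Qed.

Lemma count_inner_graft tau (t : forall v : ivert tau, btree 'I_(arity v)) P :
    (forall v, labeled (t v)) ->
  count P (inner (graft t)) =
    \sum_v count P [seq gaddr t v ++ w | w <- inner (t v)].
Proof.
elim: tau t P => [|k br IH] t P labt; first by rewrite big1 // => -[].
have uniq_t : uniq (leaves (t None)).
  by rewrite (perm_uniq (labt None)) enum_uniq.
rewrite [graft t]/= count_inner_subst // [RHS]big_option /=.
rewrite map_id; congr (_ + _).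
rewrite (perm_big _ (labt None)) big_enum /=.
pose F i (v : ivert (br i)) := count (preim (cat (laddr (t None) i)) P)
  [seq gaddr (fun u => t (up u)) v ++ w | w <- inner (t (up v))].
rewrite (eq_bigr (fun i => \sum_v F i v)) => [|i _]; last first.
  by rewrite inner_relabel count_map IH // => v; apply: (labt (up v)).
rewrite (sig_big_dep xpredT (fun=> xpredT)) /=; apply: eq_bigr => -[i v] _.
rewrite /F !count_map; apply: eq_count => w /=.
by rewrite catA.
Qed.

End PlanarTrees.

(** * Splitting the nadir map *)

Section Sequences.

(** The blocks [t i] are disjoint and contain the [s i], so filtering both concatenations by
    membership in [t i] isolates the blocks of index [i]. *)
Lemma perm_flatten_blocks (I V : eqType) (r : seq I) (s t : I -> seq V) :
    uniq (flatten (map t r)) -> {in r, forall i, {subset s i <= t i}} ->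
  perm_eq (flatten (map s r)) (flatten (map t r)) =
  all (fun i => perm_eq (s i) (t i)) r.
Proof.
elim: r => //= i r IH; rewrite cat_uniq => /and3P[_ /hasPn tdisj uniq_t] st.
have st_i : {subset s i <= t i} by apply: st; rewrite mem_head.
have st_r : {in r, forall j, {subset s j <= t j}}.
  by move=> j rj; apply: st; rewrite inE rj orbT.
have sdisj : {in flatten (map s r), forall x, x \notin t i}.
  by move=> x /flatten_mapP[j rj /(st_r _ rj) tx]; apply/tdisj/flatten_mapP; exists j.
rewrite -IH //; apply/idP/andP => [st_ir|[]]; last exact: perm_cat.
suff st_i' : perm_eq (s i) (t i).
  by split=> //; rewrite -(perm_cat2l (t i)) -(permPr st_ir) perm_cat2r perm_sym.
have := perm_filter (mem (t i)) st_ir; rewrite !filter_cat.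
have -> : [seq x <- flatten (map s r) | mem (t i) x] = [::].
  by apply/eqP; rewrite -[_ == _]negbK -has_filter; apply/hasPn.
have -> : [seq x <- flatten (map t r) | mem (t i) x] = [::].
  by apply/eqP; rewrite -[_ == _]negbK -has_filter; apply/hasPn.
rewrite !cats0 (@eq_in_filter _ _ predT (s i)) => [|x /st_i] //=.
by rewrite (@eq_in_filter _ _ predT (t i)) ?filter_predT.
Qed.

(** Exactly one [i] selects a given element of [g], so exchanging the sums over [i] and [g] gives
    equal counts. *)
Lemma perm_flatten_filter (I : finType) (E : eqType) (r : seq I) (g : seq E)
    (P : I -> pred E) :
    perm_eq r (enum I) -> {in g, forall e, exists i, P^~ e =1 pred1 i} ->
  perm_eq (flatten [seq filter (P i) g | i <- r]) g.
Proof.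
move=> r_enum Pg; apply/seq.permP => Q.
rewrite count_flatten -map_comp sumnE big_map (perm_big _ r_enum) big_enum /=.
rewrite (eq_bigr (fun i => \sum_(e <- g) (Q e && P i e))); last first.
  by move=> i _; rewrite count_filter -sum1_count big_mkcond.
rewrite exchange_big -sum1_count [RHS]big_mkcond big_seq [RHS]big_seq.
apply: eq_bigr => e /Pg[i Pi]; case: (Q e) => /=; last by rewrite big1.
by rewrite -(big_mkcond (fun i => P i e)) (eq_bigl _ _ Pi) big_pred1_eq.
Qed.

(** As a rearrangement of sequences, bijectivity of the nadir map can be split into blocks. *)
Lemma bijective_ontoE (E : finType) (V : eqType) (f : E -> V) (s : seq V) :
  uniq s -> bijective_onto f s = perm_eq (codom f) s.
Proof.
move=> uniq_s; apply/and3P/idP => [[inj_f /allP fs /allP sf]|fs].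
  by apply: uniq_perm => // x; apply/idP/idP; [apply: fs | apply: sf].
split; first by rewrite /injectiveb /dinjectiveb -codomE (perm_uniq fs).
  by apply/allP => x; rewrite /= (perm_mem fs).
by apply/allP => x; rewrite /= (perm_mem fs).
Qed.

End Sequences.

(** * Nadirs in [tau], in the trees [t v] and in the grafting *)

Section Blocks.
Variables (tau : rptree) (t : forall v : ivert tau, btree 'I_(arity v)).
Hypothesis labt : forall v, labeled (t v).

(* J_v(l); a junk value if the leaf l is not over v. *)
Definition branch (v : ivert tau) (l : 'I_(nleaves tau)) : 'I_(arity v) :=
  odflt (Ordinal (arity_gt0 v)) [pick a | over_branch (v := v) a l].

Lemma branchE v a l : over_branch (v := v) a l -> branch v l = a.
Proof.
rewrite /branch; case: pickP => [b bl al|/(_ a)->] //=.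
exact: over_branch_inj bl al.
Qed.

Lemma over_branchE v a l : over_branch (v := v) a l ->
  forall b, over_branch (v := v) b l = (b == branch v l).
Proof.
move=> al b; rewrite (branchE al).
by apply/idP/eqP => [bl|->] //; apply: over_branch_inj bl al.
Qed.

(** The form required by [perm_flatten_filter]: edges are classified by a unique internal vertex of
    [tau]. *)
Lemma vaddr_nadir (j k : 'I_(nleaves tau)) : j != k ->
  exists v, (fun u => nadir (raddr j) (raddr k) == vaddr u) =1 pred1 (v : ivert tau).
Proof.
move=> /over_branch_split[v [a [b [ab aj bk]]]]; exists v => u /=.
by rewrite (nadir_raddr ab aj bk) (inj_eq (@vaddr_inj tau)) eq_sym.
Qed.

Lemma over_branch_nadir v (j k : 'I_(nleaves tau)) :
    j != k -> nadir (raddr j) (raddr k) = vaddr v ->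
  [/\ branch v j != branch v k, over_branch (branch v j) j &
      over_branch (branch v k) k].
Proof.
move=> /over_branch_split[u [a [b [ab aj bk]]]].
rewrite (nadir_raddr ab aj bk) => /vaddr_inj uv; case: _ / uv in a b ab aj bk *.
by rewrite (branchE aj) (branchE bk).
Qed.

(** The grafted addresses extend [gaddr t v] followed by the addresses of the two branches in [t v],
    so they part at the same [w] through the same [x] and [y]. Nadirs and left-right comparisons
    thus carry over. *)
Lemma laddr_graft_split v (j k : 'I_(nleaves tau)) :
    j != k -> nadir (raddr j) (raddr k) = vaddr v ->
  exists w x y p q p' q',
    [/\ x != y, w \in inner (t v),
        laddr (t v) (branch v j) = w ++ x :: p,
        laddr (t v) (branch v k) = w ++ y :: q &
        laddr (graft t) j = (gaddr t v ++ w) ++ x :: p' /\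
        laddr (graft t) k = (gaddr t v ++ w) ++ y :: q'].
Proof.
move=> jk /(over_branch_nadir jk)[vjk vj vk].
have [w [x [y [p [q [xy wt jE kE]]]]]] :=
  laddr_split (mem_labeled _ (labt v)) (mem_labeled _ (labt v)) vjk.
have [p' p'E] := laddr_graft labt vj; have [q' q'E] := laddr_graft labt vk.
exists w, x, y, p, q, (p ++ p'), (q ++ q'); split=> //.
by rewrite p'E q'E jE kE -!catA.
Qed.

Lemma perm_inner_graft ord : perm_eq ord (enum (ivert tau)) ->
  perm_eq (flatten [seq [seq gaddr t v ++ w | w <- inner (t v)] | v <- ord])
          (inner (graft t)).
Proof.
move=> ord_enum; apply/seq.permP => P; rewrite count_inner_graft // count_flatten.
by rewrite -map_comp sumnE big_map (perm_big _ ord_enum) big_enum.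
Qed.

(** The copies of the [t v] partition the vertices of the grafting and prefixing by [gaddr t v] is
    injective, so bijectivity is decided copy by copy. *)
Lemma perm_nadir_blocks ord (s : forall v : ivert tau, seq (seq bool)) :
    perm_eq ord (enum (ivert tau)) -> (forall v, {subset s v <= inner (t v)}) ->
  perm_eq (flatten [seq [seq gaddr t v ++ w | w <- s v] | v <- ord])
          (inner (graft t)) =
  [forall v, perm_eq (s v) (inner (t v))].
Proof.
move=> ord_enum st; rewrite -(permPr (perm_inner_graft ord_enum)).
rewrite perm_flatten_blocks.
- apply/allP/forallP => [st_v v|st_v v _].
    have := st_v v; rewrite (perm_mem ord_enum) mem_enum => /(_ isT).
    by apply: perm_map_inj => w w' /eqP; rewrite eqseq_cat // eqxx => /eqP.
  exact: perm_map.
- by rewrite (perm_uniq (perm_inner_graft ord_enum)) uniq_inner.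
by move=> v _ _ /mapP[w /st wt ->]; apply: map_f.
Qed.

End Blocks.

(** * The even pairing *)

Section Even.
Local Open Scope ring_scope.
Variable R : comNzRingType.

Section Value.
Variables (I : eqType) (t : btree I).

Definition arc_nadir (e : I * I) := nadir (laddr t e.1) (laddr t e.2).

Definition left_to_right (e : I * I) :=
  lies_over (arc_nadir e) false (laddr t e.1) &&
  lies_over (arc_nadir e) true (laddr t e.2).

(** The even pairing on a bare sequence of arcs, free of connectedness, since restrictions to the
    [t v] may be disconnected. *)
Definition even_val (s : seq (I * I)) : R :=
  if perm_eq (map arc_nadir s) (inner t) then (-1) ^+ count left_to_right s
  else 0.

Lemma perm_even_val s s' : perm_eq s s' -> even_val s = even_val s'.
Proof.
move=> ss'; rewrite /even_val (permPl (perm_map arc_nadir ss')).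
by have /seq.permP -> := ss'.
Qed.

End Value.

Definition arcs m (g : digraph m) := [seq tag e | e <- enum {: edges g}].

Lemma count_arcs m (g : digraph m) P : count P (arcs g) = (\sum_(p | P p) g p)%N.
Proof.
rewrite count_map -sum1_count big_enum_cond /=.
rewrite [RHS](eq_bigr (fun p => \sum_(i < g p) 1)%N) => [|p _]; last first.
  by rewrite sum1_card card_ord.
by rewrite sig_big_dep; apply: eq_bigl => p; rewrite andbT.
Qed.

Lemma even_pair_val m (G : graph m) (T : tree m) :
  even_pair R G T = even_val (val T) (arcs (val G)).
Proof.
rewrite /even_pair bijective_ontoE ?uniq_inner // /even_val -map_comp codomE.
rewrite cardsE; congr (if _ then _ ^+ _ else _).
by rewrite -sum1_card count_map -sum1_count big_enum_cond.
Qed.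

(** If [g] is disconnected the left side is [0], and so is the right: by [inner_connected], a nadir
    map onto the internal vertices would make [g] connected. *)
Lemma even_pairing_gamma m (g : digraph m) (T : tree m) :
    (forall i, g (i, i) = 0%N) ->
  even_pairing (gamma_of R g) << T >> = even_val (val T) (arcs g).
Proof.
move=> loopless; rewrite /gamma_of /even_pairing.
case: insubP => [G _ GE|not_graph]; first by rewrite bilin11 even_pair_val GE.
rewrite bilin0l /even_val; case: ifP => // perm_g.
case/negP: not_graph; apply/andP; split; first by apply/forallP => i; rewrite loopless.
apply/forallP => i; apply/forallP => j.
apply: (inner_connected (t := val T)); try exact: mem_labeled (valP T).
  by apply: sym_connect_sym => {}i {}j /=; rewrite addnC.
move=> w; rewrite -(perm_mem perm_g) => /mapP[p]; rewrite -has_pred1 has_count.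
rewrite count_arcs big_pred1_eq; case: p => a b gab ->.
exists a, b; split; rewrite ?(mem_labeled _ (valP T)) //=.
  by apply: contraTneq gab => ->; rewrite loopless.
by rewrite addn_gt0 gab.
Qed.

Section Core.
Variables (tau : rptree) (t : forall v : ivert tau, btree 'I_(arity v)).
Hypothesis labt : forall v, labeled (t v).
Local Notation n := (nleaves tau).

Definition restr (v : ivert tau) (s : seq ('I_n * 'I_n)) :=
  [seq (branch v e.1, branch v e.2)
  | e <- s & nadir (raddr e.1) (raddr e.2) == vaddr v].

(** For an edge with nadir [v], [over_branch] pins each end to its [branch v], so both sides have
    equal multiplicities. Pairs [j = k] have multiplicity [0]. *)
Lemma perm_arcs_restr (g : digraph n) (v : ivert tau) :
    (forall i, g (i, i) = 0%N) ->
  perm_eq (arcs (even_restr g v)) (restr v (arcs g)).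
Proof.
move=> loopless; apply/allP => p _ /=; apply/eqP.
rewrite count_arcs big_pred1_eq count_map count_filter count_arcs ffunE.
rewrite big_mkcond [RHS]big_mkcond; apply: eq_bigr => -[j k] _ /=.
have [->|jk] := eqVneq j k; first by rewrite loopless !if_same.
case: p => a b; rewrite andbC; case: eqP => [nadir_jk|_]; rewrite ?andbF //= andbT.
have [_ vj vk] := over_branch_nadir jk nadir_jk.
by rewrite (over_branchE vj) (over_branchE vk) xpair_eqE andbT !(eq_sym (branch _ _)).
Qed.

Lemma even_val_graft (s : seq ('I_n * 'I_n)) :
    {in s, forall e, e.1 != e.2} ->
  even_val (graft t) s = \prod_v even_val (t v) (restr v s).
Proof.
move=> neq_s.
pose P (v : ivert tau) (e : 'I_n * 'I_n) := nadir (raddr e.1) (raddr e.2) == vaddr v.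
have Ps : {in s, forall e, exists v, P^~ e =1 pred1 v}.
  by move=> e /neq_s; apply: vaddr_nadir.
(* [even_val] ignores order, so [s] may be grouped into classes of arcs with the same nadir in
   [tau]. *)
rewrite -(perm_even_val _ (perm_flatten_filter (perm_refl _) Ps)).
have sub_t v : {subset map (arc_nadir (t v)) (restr v s) <= inner (t v)}.
  move=> u /mapP[z /mapP[e]]; rewrite mem_filter => /andP[/eqP Pe se] -> ->.
  have [w [x [y [p [q [p' [q' [xy wt jE kE _]]]]]]]] :=
    laddr_graft_split labt (neq_s _ se) Pe.
  by rewrite /arc_nadir jE kE nadir_split.
rewrite /even_val map_flatten -map_comp.
have -> : map (map (arc_nadir (graft t)) \o (fun v => filter (P v) s))
      (enum (ivert tau)) =
    [seq [seq gaddr t v ++ w | w <- map (arc_nadir (t v)) (restr v s)]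
    | v <- enum (ivert tau)].
  apply: eq_map => v /=; rewrite /restr -!map_comp; apply/eq_in_map => e /=.
  rewrite mem_filter => /andP[/eqP Pe se].
  have [w [x [y [p [q [p' [q' [xy wt jE kE [jE' kE']]]]]]]]] :=
    laddr_graft_split labt (neq_s _ se) Pe.
  by rewrite /arc_nadir jE kE jE' kE' !nadir_split.
rewrite perm_nadir_blocks //; case: forallP => [perm_s|/forallP].
  rewrite (eq_bigr (fun v => (-1) ^+ count (left_to_right (t v)) (restr v s))); last first.
    by move=> v _; rewrite perm_s.
  (* The exponents add up: an arc leaves its nadir in the grafting and in [t v] through the same
     branches, so it goes left to right in both or in neither. *)
  rewrite -expr_sum count_flatten -map_comp sumnE big_map big_enum /=.
  congr (_ ^+ _); apply: eq_bigr => v _.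
  rewrite count_map; apply: eq_in_count => e.
  rewrite mem_filter => /andP[/eqP Pe se] /=.
  have [w [x [y [p [q [p' [q' [xy wt jE kE [jE' kE']]]]]]]]] :=
    laddr_graft_split labt (neq_s _ se) Pe.
  by rewrite /left_to_right /arc_nadir jE kE jE' kE' !nadir_split // !lies_over_split.
rewrite negb_forall => /existsP[v /negPf not_perm].
by rewrite (bigD1 v) //= not_perm mul0r.
Qed.

End Core.

Lemma even_pair_graft tau (G : graph (nleaves tau))
    (t : {dffun forall v : ivert tau, tree (arity v)}) :
  even_pair R G (graft_tree t) =
  even_tpairing (even_g (<< G >> : Gamma R _)) << t >>.
Proof.
have /andP[/forallP loopless _] := valP G.
have {}loopless i : val G (i, i) = 0%N by apply/eqP.
rewrite even_pair_val even_val_graft => [|v|[i j] ij /=]; last 2 first.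
- exact: valP (t v).
- apply: contraTneq ij => ->; rewrite -has_pred1 has_count count_arcs.
  by rewrite big_pred1_eq loopless.
rewrite /even_g fglift1 [RHS]tensor_pairing_tens => [|v]; last first.
  by rewrite /gamma_of; case: insub => [K|]; [right; exists K | left].
apply: eq_bigr => v _.
rewrite -(perm_even_val _ (perm_arcs_restr v loopless)) -even_pairing_gamma //.
move=> i; rewrite ffunE big1 // => -[j k] /= /and3P[/eqP nadir_jk vj vk].
have [->//|jk] := eqVneq j k.
by have [] := over_branch_nadir jk nadir_jk; rewrite (branchE vj) (branchE vk) eqxx.
Qed.

End Even.

(** * The odd pairing *)

Section Odd.
Local Open Scope ring_scope.
Variable R : comNzRingType.

Definition odd_val (I : finType) (t : btree I) (s : seq {set I}) : R :=
  let b := edge_nadir (laddr t) in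
  if perm_eq (map b s) (inner t) then order_sign R (map b s) (inner t) else 0.

Lemma odd_pair_val m (G : eograph m) (T : tree m) :
  odd_pair R G T = odd_val (val T) (val G).
Proof.
rewrite /odd_pair bijective_ontoE ?uniq_inner // /odd_val.
by rewrite codomE (map_comp _ (tnth _)) map_tnth_enum.
Qed.

(** A disconnected [g] gives [0] on both sides, again by [inner_connected]. *)
Lemma odd_pairing_ogamma m (g : seq {set 'I_m}) (T : tree m) :
    {in g, forall e : {set 'I_m}, #|e| = 2} ->
  odd_pairing (ogamma_of R g) << T >> = odd_val (val T) g.
Proof.
move=> card_g; rewrite /ogamma_of /odd_pairing.
case: insubP => [G _ GE|not_graph]; first by rewrite bilin11 odd_pair_val GE.
rewrite bilin0l /odd_val; case: ifP => // perm_g.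
case/negP: not_graph; apply/andP; split; first by apply/allP => e /card_g ->.
apply/forallP => i; apply/forallP => j.
apply: (inner_connected (t := val T)); try exact: mem_labeled (valP T).
  by apply: sym_connect_sym => {}i {}j /=; rewrite setUC.
move=> w; rewrite -(perm_mem perm_g) => /mapP[e ge ->].
have /eqP/cards2P[a [b [ab eE]]] := card_g e ge.
exists a, b; split; rewrite ?(mem_labeled _ (valP T)) //= -?eE //.
by rewrite eE edge_nadir2.
Qed.

Section Core.
Variables (tau : rptree) (t : forall v : ivert tau, btree 'I_(arity v)).
Hypothesis labt : forall v, labeled (t v).
Local Notation n := (nleaves tau).

Lemma set_over_branch (v : ivert tau) (j k : 'I_n) :
    j != k -> nadir (raddr j) (raddr k) = vaddr v ->
  [set a | [exists l in [set j; k], over_branch (v := v) a l]] =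
  [set branch v j; branch v k].
Proof.
move=> jk /(over_branch_nadir jk)[_ vj vk]; apply/setP => a; rewrite !inE.
apply/existsP/orP => [[l /andP[]]|[]/eqP->].
- rewrite !inE => /orP[]/eqP->; first by rewrite (over_branchE vj); left.
  by rewrite (over_branchE vk); right.
- by exists j; rewrite !inE eqxx.
by exists k; rewrite !inE eqxx orbT.
Qed.

Lemma edge_nadir_graft (v : ivert tau) (e : {set 'I_n}) :
    #|e| = 2 -> edge_nadir (@raddr tau) e = vaddr v ->
  let e' := [set a | [exists l in e, over_branch (v := v) a l]] in
  [/\ #|e'| = 2, edge_nadir (laddr (t v)) e' \in inner (t v) &
      edge_nadir (laddr (graft t)) e = gaddr t v ++ edge_nadir (laddr (t v)) e'].
Proof.
move=> /eqP/cards2P[j [k [jk ->]]]; rewrite !edge_nadir2 // => nadir_jk.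
rewrite set_over_branch //; have [vjk _ _] := over_branch_nadir jk nadir_jk.
rewrite /= cards2 vjk edge_nadir2 //.
have [w [x [y [p [q [p' [q' [xy wt jE kE [jE' kE']]]]]]]]] :=
  laddr_graft_split labt jk nadir_jk.
by rewrite jE kE jE' kE' !nadir_split.
Qed.

(** In the bijective case four orders of the vertices of the grafting are compared: from left to
    right, tree by tree, and as nadirs of edges in the order of [g] or of [tensor_edges]. The
    identity is the cocycle rule around this square, each sign being its own inverse. *)
Lemma odd_val_graft (ord : seq (ivert tau)) (g : seq {set 'I_n}) :
    perm_eq ord (enum (ivert tau)) -> {in g, forall e : {set 'I_n}, #|e| = 2} ->
  order_sign R (flatten [seq [seq gaddr t v ++ w | w <- inner (t v)] | v <- ord])
    (inner (graft t)) * odd_val (graft t) g =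
  order_sign R (tensor_edges ord g) (iota 0 (size g)) *
    \prod_v odd_val (t v) (odd_restr g v).
Proof.
move=> ord_enum card_g.
(* Edges are represented by positions in [g], because the same pair of endpoints may be repeated. *)
pose P (v : ivert tau) i := edge_nadir (@raddr tau) (nth set0 g i) == vaddr v.
pose b i := edge_nadir (laddr (graft t)) (nth set0 g i).
have perm_te : perm_eq (tensor_edges ord g) (iota 0 (size g)).
  apply: (perm_flatten_filter (P := P)) => // i; rewrite mem_iota add0n /= => lt_i.
  have /eqP/cards2P[j [k [jk ge]]] := card_g _ (mem_nth set0 lt_i).
  by rewrite /P ge edge_nadir2 //; apply: vaddr_nadir.
have map_b : map b (iota 0 (size g)) = map (edge_nadir (laddr (graft t))) g.
  by rewrite (map_comp _ (nth set0 g)) map_nth_iota0 ?take_size.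
pose s v := map (edge_nadir (laddr (t v))) (odd_restr g v).
have restr_b v :
    [seq gaddr t v ++ w | w <- s v] = map b (filter (P v) (iota 0 (size g))).
  have gE : [seq e <- g | edge_nadir (@raddr tau) e == vaddr v] =
      map (nth set0 g) (filter (P v) (iota 0 (size g))).
    by rewrite -{1}[g](mkseq_nth set0) /mkseq filter_map.
  rewrite /s /odd_restr gE -!map_comp; apply/eq_in_map => i.
  rewrite mem_filter mem_iota add0n /= => /andP[/eqP Pi lt_i].
  by rewrite /b /=; have [_ _ ->] := edge_nadir_graft (card_g _ (mem_nth set0 lt_i)) Pi.
have te_b : map b (tensor_edges ord g) =
    flatten [seq [seq gaddr t v ++ w | w <- s v] | v <- ord].
  by rewrite map_flatten -map_comp; congr flatten; apply: eq_map => v /=.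
have sub_t v : {subset s v <= inner (t v)}.
  move=> u /mapP[z /mapP[e]]; rewrite mem_filter => /andP[/eqP Pe ge] -> ->.
  by have [] := edge_nadir_graft (card_g e ge) Pe.
have perm_b : perm_eq (map b (tensor_edges ord g)) (map b (iota 0 (size g))).
  exact: perm_map.
have perm_i := perm_inner_graft labt ord_enum.
rewrite /odd_val -map_b -(permPl perm_b) te_b perm_nadir_blocks //.
(* If the nadir map into some [t v] is not bijective, both sides are [0]. *)
case: forallP => [perm_s|/forallP]; last first.
  rewrite negb_forall => /existsP[v /negPf not_perm].
  by rewrite (bigD1 v) //= not_perm mul0r !mulr0.
have perm_X : perm_eq (map b (tensor_edges ord g)) (inner (graft t)).
  by rewrite te_b perm_nadir_blocks //; apply/forallP.
have uniq_X : uniq (map b (tensor_edges ord g)).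
  by rewrite (perm_uniq perm_X) uniq_inner.
(* Prefixing by [gaddr t v] makes each factor a sign between vertices of the grafting, ready for
   [order_sign_flatten]. *)
rewrite (eq_bigr (fun v => order_sign R [seq gaddr t v ++ w | w <- s v]
    [seq gaddr t v ++ w | w <- inner (t v)])); last first.
  move=> v _; rewrite perm_s order_sign_map //.
  rewrite map_inj_uniq => [|w w' /eqP]; last by rewrite eqseq_cat // eqxx => /eqP.
  by rewrite (perm_uniq (perm_s v)) uniq_inner.
rewrite -big_enum -(perm_big _ ord_enum) -order_sign_flatten => [||v]; last 2 first.
- by rewrite -te_b.
- exact: perm_map.
rewrite -te_b -(order_sign_map R uniq_X perm_te).
set TI := flatten [seq [seq _ | w <- inner (t v)] | v <- ord].
have perm_TI : perm_eq (map b (tensor_edges ord g)) TI.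
  by rewrite (permPl perm_X) perm_sym.
(* Two routes from the nadirs in the order of [tensor_edges] to the left-to-right order: through the
   order of [g], and through [TI]. *)
have eq_XS :
    order_sign R (map b (tensor_edges ord g)) (map b (iota 0 (size g))) *
      order_sign R (map b (iota 0 (size g))) (inner (graft t)) =
    order_sign R (map b (tensor_edges ord g)) TI *
      order_sign R TI (inner (graft t)).
  by rewrite -!order_sign_trans // -(permPl perm_b).
have := order_sign_sqr R TI (inner (graft t)).
have := order_sign_sqr R (map b (tensor_edges ord g)) (map b (iota 0 (size g))).
move: eq_XS; set a := order_sign R _ (map b _); set c := order_sign R _ TI.
set d := order_sign R TI _; set e := order_sign R _ _ => ae aa dd.
have {1}-> : e = a * c * d by rewrite -mulrA -ae mulrA aa mul1r.
by rewrite mulrCA dd mulr1.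
Qed.


End Core.

Lemma odd_pair_graft tau (ord : seq (ivert tau)) (G : eograph (nleaves tau))
    (t : {dffun forall v : ivert tau, tree (arity v)}) :
    perm_eq ord (enum (ivert tau)) ->
  order_sign R (tensor_inner ord t) (inner (val (graft_tree t))) *
    odd_pair R G (graft_tree t) =
  odd_tpairing (odd_g ord (<< G >> : oGamma R _)) << t >>.
Proof.
move=> ord_enum; have /andP[/allP card_G _] := valP G.
have {}card_G : {in val G, forall e : {set _}, #|e| = 2} by move=> e /card_G/eqP.
have labt v : labeled (val (t v)) := valP (t v).
rewrite odd_pair_val odd_val_graft // /odd_g fglift1 [RHS]bilinZl.
congr (_ * _); rewrite -[RHS]/(tensor_pairing (fun v => @odd_pair R (arity v)) _ _).
rewrite tensor_pairing_tens => [|v]; last first.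
  by rewrite /ogamma_of; case: insub => [K|]; [right; exists K | left].
apply: eq_bigr => v _; rewrite -odd_pairing_ogamma // => u /mapP[e].
rewrite mem_filter => /andP[/eqP Pe Ge] ->.
by have [] := edge_nadir_graft labt (card_G e Ge) Pe.
Qed.

End Odd.

(** * From basis elements to linear combinations *)

Theorem theorem6p5 (R : comNzRingType) (tau : rptree)
    (ord : seq (ivert tau)) (ord_enum : perm_eq ord (enum (ivert tau)))
    (T : forall v : ivert tau, Theta R (arity v)) :
  (forall G : Gamma R (nleaves tau),
     even_pairing G (even_f (tens T)) = even_tpairing (even_g G) (tens T))
  /\
  (forall G : oGamma R (nleaves tau),
     odd_pairing G (odd_f ord (tens T)) = odd_tpairing (odd_g ord G) (tens T)).
Proof.
(* With the structure maps moved into the kernels, both sides are bilinear extensions over [G] and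
   [tens T], so the kernels need only agree on a graph [g] and a family [t]. *)
split=> G; rewrite [LHS]bilin_fglift_r [RHS]bilin_fglift_l; apply: eq_bilin => g t.
  by rewrite bilin11 even_pair_graft /even_g fglift1.
by rewrite /bilin fglift1 liftU [LHS]odd_pair_graft // /odd_g fglift1.
Qed.
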